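(* Let $T_1$ and $T_2$ be maps. Then $$\sigma(\mathsf{d}_{T_1\times T_2})\le\sigma(\mathsf{d}_{T_1})+\sigma(\mathsf{d}_{T_2})+1.$$
   Context: A map means a map $T:X\to X$ of a set (e.g. a continuous map of a compact metric space). A closed orbit of length $n$ is a set of the form $\{x,Tx,\dots,T^{n}x=x\}$ with cardinality $n$; $\mathsf{O}_T(n)$ is the number of closed orbits of length $n$ under $T$, and it is always assumed that $\mathsf{O}_T(n)<\infty$ for all $n\ge1$. The orbit Dirichlet series associated to $T$ is $\mathsf{d}_T(s)=\sum_{n=1}^{\infty}\frac{\mathsf{O}_T(n)}{n^s}$, convergent on a (possibly empty) half-plane $\Re(s)>\sigma(\mathsf{d}_T)$, where $\sigma(\mathsf{d}_T)$ is the abscissa of convergence. $T_1\times T_2$ is the Cartesian product map $(x,y)\mapsto(T_1x,T_2y)$.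
   Formalization: Excluded: one map has abscissa −∞ and at least one closed orbit while the other's abscissa is not −∞; there the bound fails (e.g. T_1 the identity of a point, T_2 with infinitely many closed orbits and finite abscissa) or its right side −∞+∞ is undefined. *)

(* Defs.v *)
From HB Require Import structures.
From mathcomp Require Import all_boot all_order all_algebra.
From mathcomp Require Import all_classical all_reals all_analysis.
From mathcomp Require Import finmap complex.

Set Implicit Arguments.
Unset Strict Implicit.
Unset Printing Implicit Defensive.

Import Order.TTheory GRing.Theory Num.Theory.
Import numFieldNormedType.Exports.

Local Open Scope classical_set_scope.
Local Open Scope ring_scope.

(* The closed orbits {x, T x, ..., T^n x = x} of cardinality n; there are none
   for n = 0. *)
Definition closed_orbits (X : Type) (T : X -> X) (n : nat) : set (set X) :=
  [set A | (A #= `I_n)%card /\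
           exists2 x : X, iter n T x = x & A = [set iter k T x | k in `I_n.+1]].

(* [fset_set] is only meaningful on finite sets: the number below is the number
   of closed orbits when [closed_orbits T n] is finite, and 0 otherwise. *)
Definition orbit_count (X : Type) (T : X -> X) (n : nat) : nat :=
  #|` fset_set (closed_orbits T n)|.

Definition finitely_many_orbits (X : Type) (T : X -> X) : Prop :=
  forall n : nat, (0 < n)%N -> finite_set (closed_orbits T n).

Definition prod_map (X1 X2 : Type) (T1 : X1 -> X1) (T2 : X2 -> X2) :
    X1 * X2 -> X1 * X2 :=
  fun p => (T1 p.1, T2 p.2).

Definition cexp (R : realType) (z : R[i]) : R[i] :=
  Complex (expR (complex.Re z) * cos (complex.Im z))
          (expR (complex.Re z) * sin (complex.Im z)).

(* n^s for n >= 1 and complex s *)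
Definition cpow (R : realType) (n : nat) (s : R[i]) : R[i] :=
  cexp (s * real_complex R (ln n%:R)).

(* Partial sums of \sum_(n >= 1) a n / n^s. The alias R[i]^o carries the
   topology of the complex modulus. *)
Definition dirichlet_series (R : realType) (a : nat -> nat) (s : R[i]) :
    nat -> R[i]^o :=
  fun N => \sum_(1 <= n < N.+1) (a n)%:R / cpow n s.

(* The largest open half-plane of convergence is Re s > abscissa a: the value is
   +oo when there is none, and -oo when the series converges everywhere. *)
Definition abscissa (R : realType) (a : nat -> nat) : \bar R :=
  ereal_inf [set c%:E | c in
    [set c : R | forall s : R[i], c < complex.Re s ->
                   cvgn (dirichlet_series a s)]].

Definition orbit_abscissa (R : realType) (X : Type) (T : X -> X) : \bar R :=
  abscissa R (orbit_count T).

(* Main.v *)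
(* Write O, O1, O2 for the orbit counts of T1 x T2, T1, T2. A closed orbit of
   length n of the product projects to closed orbits of lengths a and b with
   lcm(a, b) = n, and at most n of them have the same projections, so
   O(n) <= n * sum_(lcm(a, b) = n) O1(a) O2(b).
   For s1, s2 >= 0 one has lcm(a, b)^(-(s1 + s2)) <= a^(-s1) b^(-s2), hence the
   partial sums of the product series at s1 + s2 + 1 are at most the product of
   those of the factors at s1 and s2. A negative abscissa forces an integer
   sequence to be eventually zero, so the remaining cases are degenerate. *)
Require Import Defs.
From HB Require Import structures.
From mathcomp Require Import all_boot all_order all_algebra.
From mathcomp Require Import all_classical all_reals all_analysis.
From mathcomp Require Import finmap complex.

Set Implicit Arguments.
Unset Strict Implicit.
Unset Printing Implicit Defensive.

Import Order.TTheory GRing.Theory Num.Theory.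

Local Open Scope ring_scope.

(** * Concatenations of lists *)

Lemma mem_big_cat (I T : eqType) (s : seq I) (P : pred I) (F : I -> seq T) i x :
  i \in s -> P i -> x \in F i -> x \in \big[cat/[::]]_(j <- s | P j) F j.
Proof.
move=> + Pi xi; elim: s => [|j s IH] //; rewrite in_cons big_cons.
move=> /predU1P[<-|/IH]; first by rewrite Pi mem_cat xi.
by case: ifP => // _ xs; rewrite mem_cat xs orbT.
Qed.

Lemma size_big_cat (I T : Type) (s : seq I) (P : pred I) (F : I -> seq T) :
  size (\big[cat/[::]]_(j <- s | P j) F j) = (\sum_(j <- s | P j) size (F j))%N.
Proof. exact: (big_morph size (@size_cat T)). Qed.

(** * Least periods, closed orbits and orbit counts of products *)

Section Orbits.
Local Open Scope classical_set_scope.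

(** The least period, encoded by divisibility so that periods of pairs become least common
    multiples. *)
Definition has_period (X : Type) (T : X -> X) (x : X) (n : nat) : Prop :=
  (0 < n)%N /\ forall m : nat, iter m T x = x <-> (n %| m)%N.

Definition forward_orbit (X : Type) (T : X -> X) (x : X) : set X :=
  range (fun k => iter k T x).

Lemma iter_period (X : Type) (T : X -> X) (x : X) (n q : nat) :
  iter n T x = x -> iter (q * n) T x = x.
Proof. by move=> Tx; elim: q => [|q IH] //; rewrite mulSn iterD IH. Qed.

Lemma iter_modn (X : Type) (T : X -> X) (x : X) (n m : nat) :
  iter n T x = x -> iter (m %% n) T x = iter m T x.
Proof.
by move=> Tx; rewrite {2}(divn_eq m n) addnC iterD iter_period.
Qed.

Lemma has_period_ex (X : Type) (T : X -> X) (x : X) (n : nat) :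
  (0 < n)%N -> iter n T x = x -> exists p, has_period T x p.
Proof.
move=> n0 Tx.
have ex : exists k, (0 < k)%N && `[< iter k T x = x >].
  by exists n; rewrite n0; apply/asboolP.
case: (ex_minnP ex) => p /andP[p0 /asboolP Tp] pmin.
exists p; split=> // m; split=> [Tm|/dvdnP[q ->]]; last exact: iter_period.
rewrite /dvdn; apply/negPn/negP; rewrite -lt0n => r0.
have := ltn_pmod m p0; rewrite ltnNge => /negP; apply.
by apply: pmin; rewrite r0; apply/asboolP; rewrite iter_modn.
Qed.

Lemma image_iter_period (X : Type) (T : X -> X) (x : X) (n m : nat) :
  (0 < n)%N -> (n <= m)%N -> iter n T x = x ->
  [set iter k T x | k in `I_m] = forward_orbit T x.
Proof.
move=> n0 nm Tx; apply/seteqP; split=> [_ [k _ <-]|_ [k _ <-]].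
  by exists k.
exists (k %% n)%N; last exact: iter_modn.
exact: leq_trans (ltn_pmod k n0) nm.
Qed.

Lemma card_forward_orbit (X : Type) (T : X -> X) (x : X) (n : nat) :
  has_period T x n -> (forward_orbit T x #= `I_n)%card.
Proof.
move=> [n0 Tn].
have Tx : iter n T x = x by apply/Tn.
rewrite -(image_iter_period n0 (leqnn n) Tx).
apply: inj_card_eq => i j /set_mem/= ilt /set_mem/= jlt.
wlog ij : i j ilt jlt / (i <= j)%N.
  by move=> H E; case/orP: (leq_total i j) => h; [|apply/esym]; apply: H.
(* Applying [n - i] further steps to both sides turns the coincidence into a return time, whence [n]
   divides [j - i < n]. *)
move=> E; have : iter (j + (n - i)) T x = x.
  by rewrite addnC iterD -E -iterD subnK // ltnW.
move/Tn; rewrite addnBA; last exact: ltnW.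
rewrite addnC -addnBA // dvdn_addr // => d.
apply/eqP; rewrite eqn_leq ij /= -subn_eq0; apply/negPn/negP; rewrite -lt0n => d0.
have := dvdn_leq d0 d; rewrite leqNgt => /negP; apply.
exact: leq_ltn_trans (leq_subr _ _) jlt.
Qed.

(** A return time [n] need only be a multiple of the least period [p]; the cardinality condition
    forces [n = p], since an orbit of least period [p] has [p] points. *)
Lemma closed_orbitsP (X : Type) (T : X -> X) (n : nat) (A : set X) :
  closed_orbits T n A <-> exists2 x, has_period T x n & A = forward_orbit T x.
Proof.
split=> [[cA [x Tx AE]]|[x xn ->]].
  have n0 : (0 < n)%N.
    rewrite lt0n; apply/negP => /eqP n0; move: cA.
    rewrite n0 II0 card_eq0 AE => /eqP/seteqP[+ _].
    by move=> /(_ x); apply; exists 0%N.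
  have AE' : A = forward_orbit T x.
    by rewrite AE (image_iter_period n0 (leqnSn n) Tx).
  have [p xp] := has_period_ex n0 Tx.
  suff -> : n = p by exists x.
  apply/card_eq_II; apply: card_eq_trans (card_forward_orbit xp).
  by rewrite -AE' card_eq_sym.
split; first exact: card_forward_orbit.
have [n0 Tn] := xn; have Tx : iter n T x = x by apply/Tn.
by exists x => //; rewrite (image_iter_period n0 (leqnSn n) Tx).
Qed.

Lemma forward_orbit_iter (X : Type) (T : X -> X) (x : X) (n k : nat) :
  has_period T x n -> forward_orbit T (iter k T x) = forward_orbit T x.
Proof.
move=> [n0 Tn].
have Tx : iter n T x = x by apply/Tn.
apply/seteqP; split=> [_ [m _ <-]|_ [m _ <-]]; first by rewrite -iterD; exists (m + k)%N.
(* On the orbit, [k * n - k] further steps undo the first [k]. *)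
exists (m + (k * n - k))%N => //; rewrite -iterD -addnA subnK ?leq_pmulr//.
by rewrite iterD iter_period.
Qed.

Lemma iter_prod_map (X1 X2 : Type) (T1 : X1 -> X1) (T2 : X2 -> X2) z k :
  iter k (prod_map T1 T2) z = (iter k T1 z.1, iter k T2 z.2).
Proof. by elim: k => [|k IH] /=; [case: z | rewrite IH]. Qed.

(** A pair returns exactly when both coordinates do, so [n] and [lcmn a b] have the same
    multiples. *)
Lemma has_period_prod (X1 X2 : Type) (T1 : X1 -> X1) (T2 : X2 -> X2) z n :
  has_period (prod_map T1 T2) z n ->
  exists a b, [/\ has_period T1 z.1 a, has_period T2 z.2 b & lcmn a b = n].
Proof.
case=> n0 Tn.
have := (Tn n).2 (dvdnn n); rewrite iter_prod_map {3}(surjective_pairing z).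
move=> [/(has_period_ex n0)[a [a0 Ta]] /(has_period_ex n0)[b [b0 Tb]]].
exists a, b; split=> //.
have TE m : (lcmn a b %| m)%N <-> (n %| m)%N.
  rewrite -Tn iter_prod_map {3}(surjective_pairing z) dvdn_lcm; split.
    by move=> /andP[/Ta -> /Tb ->].
  by move=> [/Ta -> /Tb ->].
apply/eqP; rewrite eqn_dvd; apply/andP; split; first exact/(TE n).2.
exact/(TE _).1.
Qed.

(** The covering list also yields finiteness, so [fset_set] does not take its default value. *)
Lemma orbit_count_le_size (X : Type) (T : X -> X) n (L : seq (set X)) :
  (forall A, closed_orbits T n A -> A \in L) -> (orbit_count T n <= size L)%N.
Proof.
move=> CL.
have fC : finite_set (closed_orbits T n).
  by apply: (sub_finite_set (B := [set` L])) => //; exact: finite_seq.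
apply: uniq_leq_size; first exact: fset_uniq.
move=> A; rewrite in_fset_set // => /set_mem; exact: CL.
Qed.

(* Fix representatives r1, r2 of the projections A1, A2 of a closed orbit of the
   product: the orbit passes through (r1, T2^k r2) for some k < n, hence at most
   n closed orbits share the same projections. *)
Lemma orbit_count_prod (X1 X2 : Type) (T1 : X1 -> X1) (T2 : X2 -> X2)
    (fin1 : finitely_many_orbits T1) (fin2 : finitely_many_orbits T2) n N :
  (n <= N)%N ->
  (orbit_count (prod_map T1 T2) n <=
   \sum_(1 <= a < N.+1) \sum_(1 <= b < N.+1 | lcmn a b == n)
     n * (orbit_count T1 a * orbit_count T2 b))%N.
Proof.
move=> nN.
(* A periodic point [z0] supplies the values of the representative functions at empty sets; without
   one there is nothing to count. *)
have [[B [z0 _ _]]|C0] := pselect (exists B, exists2 z,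
    has_period (prod_map T1 T2) z n & B = forward_orbit (prod_map T1 T2) z); last first.
  suff /leq_trans : (orbit_count (prod_map T1 T2) n <= 0)%N by apply.
  apply: (@orbit_count_le_size _ _ _ [::]) => A /closed_orbitsP[z zn AE].
  by case: C0; exists A, z.
have rep (X : Type) (x : X) : exists r : set X -> X, forall A y, A y -> A (r A).
  have [|r rP] := @choice (set X) X (fun A y => forall x, A x -> A y).
    move=> A; have [[y Ay]|nA] := pselect (exists y, A y); first by exists y.
    by exists x => y Ay; case: nA; exists y.
  by exists r => A y; exact: rP.
have [r1 r1P] := rep _ z0.1; have [r2 r2P] := rep _ z0.2.
pose F (A : set X1 * set X2) k :=
  forward_orbit (prod_map T1 T2) (r1 A.1, iter k T2 (r2 A.2)).
pose L a b := [seq F A k |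
  A <- [seq (A1, A2) | A1 <- fset_set (closed_orbits T1 a),
                       A2 <- fset_set (closed_orbits T2 b)], k <- iota 0 n].
have sL a b : size (L a b) = (n * (orbit_count T1 a * orbit_count T2 b))%N.
  by rewrite !size_allpairs size_iota mulnC.
under eq_bigr do under eq_bigr do rewrite -sL.
under eq_bigr do rewrite -size_big_cat.
rewrite -size_big_cat.
apply: orbit_count_le_size => A /closed_orbitsP[z zn ->].
have [n0 Tn] := zn.
have [a [b [xa yb ab]]] := has_period_prod zn.
have [[a0 _] [b0 Tb]] := (xa, yb).
have an : (a <= n)%N by rewrite -ab dvdn_leq ?dvdn_lcml// ab.
have bn : (b <= n)%N by rewrite -ab dvdn_leq ?dvdn_lcmr// ab.
have xA : closed_orbits T1 a (forward_orbit T1 z.1) by apply/closed_orbitsP; exists z.1.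
have yA : closed_orbits T2 b (forward_orbit T2 z.2) by apply/closed_orbitsP; exists z.2.
have [i _ iE] := r1P (forward_orbit T1 z.1) z.1 (ex_intro2 _ _ 0%N I erefl).
have [j _ jE] := r2P (forward_orbit T2 z.2) z.2 (ex_intro2 _ _ 0%N I erefl).
(* At time [i] the first coordinate is its representative; the second is then some [T2]-iterate of
   the other representative. *)
have /= : forward_orbit T2 (r2 (forward_orbit T2 z.2)) (iter i T2 z.2).
  by rewrite -{1}jE (forward_orbit_iter _ yb); exists i.
case=> k _ kE.
(* As [b] divides [n], the exponent [k] can be reduced modulo [n] into the range listed in [L]. *)
have ry : iter n T2 (r2 (forward_orbit T2 z.2)) = r2 (forward_orbit T2 z.2).
  rewrite -jE -iterD addnC iterD (_ : iter n T2 z.2 = z.2)//.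
  by apply/Tb; rewrite -ab dvdn_lcmr.
have AE : forward_orbit (prod_map T1 T2) z =
    F (forward_orbit T1 z.1, forward_orbit T2 z.2) (k %% n)%N.
  by rewrite /F /= (iter_modn _ ry) kE -iE -iter_prod_map (forward_orbit_iter _ zn).
apply: (@mem_big_cat _ _ _ _ _ a) => //.
  by rewrite mem_index_iota a0 ltnS (leq_trans an).
apply: (@mem_big_cat _ _ _ _ _ b); [|exact/eqP|].
  by rewrite mem_index_iota b0 ltnS (leq_trans bn).
rewrite AE; apply: allpairs_f.
  by apply: allpairs_f; rewrite in_fset_set; [exact: mem_set|exact: fin1
    |exact: mem_set|exact: fin2].
by rewrite mem_iota ltn_pmod.
Qed.
End Orbits.

(** * Convergence of Dirichlet series and the abscissa *)

Section Dirichlet.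
Variable R : realType.
Import numFieldNormedType.Exports.
Local Open Scope classical_set_scope.
Local Open Scope complex_scope.

Lemma complex_norm_le (z : R[i]) : `|z| <= (`|complex.Re z| + `|complex.Im z|)%:C.
Proof.
rewrite normc_def lecR -[leRHS]ger0_norm ?addr_ge0// -sqrtr_sqr ler_wsqrtr//.
rewrite sqrrD !real_normK ?num_real// -addrA lerD2l lerDr.
by rewrite mulrn_wge0 ?mulr_ge0.
Qed.

Lemma cvgn_complex (u : nat -> R[i]) :
  cvgn (fun n => complex.Re (u n) : R^o) -> cvgn (fun n => complex.Im (u n) : R^o) ->
  cvgn (u : nat -> R[i]^o).
Proof.
move=> /cvg_ex[x /cvgrPdist_lt xu] /cvg_ex[y /cvgrPdist_lt yu].
apply/cvg_ex; exists (Complex x y); apply/cvgrPdist_lt => e.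
rewrite ltcE /= => /andP[/eqP ei e0].
have e20 : 0 < complex.Re e / 2 by rewrite divr_gt0.
near=> n.
apply: (le_lt_trans (complex_norm_le _)).
rewrite ltcE /= ei eqxx /= [ltRHS]splitr ltrD//.
  have -> : complex.Re (Complex x y - u n) = x - complex.Re (u n) by case: (u n).
  near: n; exact: xu.
have -> : complex.Im (Complex x y - u n) = y - complex.Im (u n) by case: (u n).
near: n; exact: yu.
Unshelve. all: by end_near. Qed.

Lemma norm_complex_ge_ReIm (z : R[i]) (r : R) :
  `|z| <= r%:C -> `|complex.Re z| <= r /\ `|complex.Im z| <= r.
Proof.
rewrite normc_def lecR => zr.
by split; apply: le_trans zr; rewrite -sqrtr_sqr ler_wsqrtr// ?lerDl ?lerDr sqr_ge0.
Qed.

(** Real and imaginary parts converge absolutely by comparison with [b]. *)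
Lemma cvgn_complex_series (t : nat -> R[i]) (b : nat -> R) (M : R) :
  (forall n, `|t n| <= (b n)%:C) ->
  (forall N, \sum_(0 <= n < N) b n <= M) ->
  cvgn ((fun N => \sum_(0 <= n < N) t n) : nat -> R[i]^o).
Proof.
move=> tb bM.
have b0 n : 0 <= b n by have := le_trans (normr_ge0 _) (tb n); rewrite lecR.
have cb : cvgn (series b).
  apply: nondecreasing_is_cvgn.
    by apply/nondecreasing_seqP => n; rewrite -subr_ge0 seriesSB.
  by exists M => _ [N _ <-]; exact: bM.
have cv (f : R[i] -> R) : {morph f : x y / x + y} -> f 0 = 0 ->
    (forall z r, `|z| <= r%:C -> `|f z| <= r) ->
    cvgn (fun N => f (\sum_(0 <= n < N) t n) : R^o).
  move=> fD f0 fr.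
  have -> : (fun N => f (\sum_(0 <= n < N) t n)) = series (f \o t).
    by apply/funext => N; exact: (big_morph f fD).
  apply: normed_cvg; apply: series_le_cvg cb => // n; [exact: normr_ge0|exact: fr].
apply: cvgn_complex; [apply: (cv (@complex.Re R))|apply: (cv (@complex.Im R))] => //.
- by case=> ? ? [].
- by move=> z r /norm_complex_ge_ReIm[].
- by case=> ? ? [].
- by move=> z r /norm_complex_ge_ReIm[].
Qed.

Lemma norm_cpow (n : nat) (s : R[i]) :
  `|cpow n s| = (expR (complex.Re s * ln n%:R))%:C.
Proof.
rewrite normc_def /cpow /cexp /=; congr (_%:C).
rewrite !exprMn -mulrDr cos2Dsin2 mulr1 sqrtr_sqr ger0_norm ?expR_ge0//.
by congr expR; case: s => x y /=; rewrite mulr0 subr0.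
Qed.

Lemma cpow_real (n : nat) (x : R) : cpow n x%:C = (expR (x * ln n%:R))%:C.
Proof.
rewrite /cpow /cexp -rmorphM /= sin0 cos0 mulr1 mulr0.
by [].
Qed.

(** The terms are nonnegative, so this is convergence at the real point [x], stated without complex
    numbers. *)
Definition dirichlet_bounded (a : nat -> nat) (x : R) : Prop :=
  exists M : R, forall N : nat,
    \sum_(1 <= n < N.+1) (a n)%:R * expR (- x * ln n%:R) <= M.

Lemma dirichlet_bounded_cvg (a : nat -> nat) (x : R) (s : R[i]) :
  dirichlet_bounded a x -> x <= complex.Re s -> cvgn (dirichlet_series a s).
Proof.
move=> [M aM] xs.
have -> : dirichlet_series a s =
    (fun N => \sum_(0 <= n < N) (a n.+1)%:R / cpow n.+1 s) :> (nat -> R[i]^o).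
  by apply/funext => N; rewrite /dirichlet_series big_add1.
apply: (@cvgn_complex_series _ (fun n => (a n.+1)%:R * expR (- x * ln n.+1%:R)) M) => [n|N].
  rewrite normrM normfV norm_cpow normr_nat rmorphM rmorph_nat ler_wpM2l//.
  rewrite -fmorphV lecR -expRN ler_expR mulNr lerN2 ler_wpM2r//.
  by rewrite ln_ge0// ler1n.
by have := aM N; rewrite big_add1.
Qed.

Lemma cvg_dirichlet_bounded (a : nat -> nat) (x : R) :
  cvgn (dirichlet_series a x%:C) -> dirichlet_bounded a x.
Proof.
move=> /cvg_seq_bounded [M0 [M0r H]].
have /H{H} : (M0 < M0 + 1)%R by rewrite ltrDl.
(* The bound comes as a real element of [R[i]] and is brought back to [R]. *)
have [M <-] : exists M, M%:C = M0 + 1.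
  exists (complex.Re (M0 + 1)).
  by apply: RRe_real; rewrite realD.
move=> H; exists M => N.
have /= := H N I.
have -> : dirichlet_series a x%:C N =
    (\sum_(1 <= n < N.+1) (a n)%:R * expR (- x * ln n%:R))%:C.
  rewrite /dirichlet_series rmorph_sum; apply: eq_bigr => n _.
  by rewrite cpow_real rmorphM rmorph_nat mulNr expRN fmorphV.
move=> /norm_complex_ge_ReIm[+ _] /=; exact: le_trans (ler_norm _).
Qed.

Lemma abscissa_lt_bounded (a : nat -> nat) (x : R) :
  (abscissa R a < x%:E)%E -> dirichlet_bounded a x.
Proof.
move=> /ereal_inf_lt[_ [c cv <-]]; rewrite lte_fin => cx.
exact/cvg_dirichlet_bounded/cv.
Qed.

Lemma bounded_abscissa_le (a : nat -> nat) (x : R) :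
  dirichlet_bounded a x -> (abscissa R a <= x%:E)%E.
Proof.
move=> ax; apply: ereal_inf_lbound; exists x => // s /ltW.
exact: dirichlet_bounded_cvg.
Qed.

Lemma abscissa_finite_support (a : nat -> nat) (N : nat) :
  (forall n, (N < n)%N -> a n = 0%N) -> abscissa R a = -oo%E.
Proof.
move=> aN.
have H x : (abscissa R a <= x%:E)%E.
  apply: bounded_abscissa_le.
  exists (\sum_(1 <= n < N.+1) (a n)%:R * expR (- x * ln n%:R)) => K.
  have [KN|NK] := leqP K N.
    rewrite [leRHS](@big_cat_nat _ _ _ K.+1)//= lerDl.
    by apply: sumr_ge0 => n _; rewrite mulr_ge0 ?expR_ge0.
  rewrite (@big_cat_nat _ _ _ N.+1)//=; last by rewrite ltnS ltnW.
  rewrite [X in _ + X <= _]big_nat [X in _ + X <= _]big1 ?addr0// => n /andP[Nn _].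
  by rewrite aN// mul0r.
case: (abscissa R a) H => [r| |] // H.
  by have := H (r - 1); rewrite lee_fin leNgt gtrBl ltr01.
by have := H 0.
Qed.

(* For x < 0 the weights n^{-x} tend to infinity, and the coefficients are
   integers. *)
Lemma abscissa_lt0 (a : nat -> nat) :
  (abscissa R a < 0)%E -> exists N, forall n, (N < n)%N -> a n = 0%N.
Proof.
move=> /ereal_inf_lt[_ [c cv <-]]; rewrite lte_fin => c0.
have c20 : c / 2 < 0 by rewrite pmulr_llt0.
(* As [c < 0], the point [c / 2] is still negative and lies to the right of [c]. *)
have [M aM] : dirichlet_bounded a (c / 2).
  apply/cvg_dirichlet_bounded/cv => /=.
  by rewrite -subr_gt0 -{2}(mulr1 c) -mulrBr nmulr_rgt0// subr_lt0 invf_lt1// ltr1n.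
set e := - (c / 2) in aM; have e0 : 0 < e by rewrite oppr_gt0.
(* If [a n] is nonzero, its term alone gives [n^e <= M], that is, [n <= M^(1/e)]; the witness
   exceeds this. *)
exists (Num.bound (expR (ln M / e))) => n nN.
apply/eqP/negPn/negP; rewrite -lt0n => an.
have n0 : (0 < n)%N by exact: leq_ltn_trans nN.
have M1 : expR (e * ln n%:R) <= M.
  apply: le_trans (aM n); rewrite big_nat_recr//= -[leLHS]add0r lerD//.
    by rewrite sumr_ge0// => k _; rewrite mulr_ge0// expR_ge0.
  by rewrite ler_peMl ?expR_ge0// ler1n.
have M0 : 0 < M by apply: lt_le_trans M1; exact: expR_gt0.
have : n%:R <= expR (ln M / e) :> R.
  rewrite -[leLHS]lnK ?posrE ?ltr0n// ler_expR ler_pdivlMr// mulrC.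
  by rewrite -ler_expR lnK.
apply/negP; rewrite -ltNge.
apply: (lt_le_trans (archi_boundP (expR_ge0 _))).
by rewrite ler_nat ltnW.
Qed.

End Dirichlet.

(** * Comparison of series along least common multiples *)

Lemma dirichlet_bounded_lcm (R : realType) (a1 a2 c : nat -> nat) (x1 x2 : R) :
  (forall n N, (n <= N)%N -> (c n <=
    \sum_(1 <= a < N.+1) \sum_(1 <= b < N.+1 | lcmn a b == n)
      n * (a1 a * a2 b))%N) ->
  0 <= x1 -> 0 <= x2 -> dirichlet_bounded a1 x1 -> dirichlet_bounded a2 x2 ->
  dirichlet_bounded c (x1 + x2 + 1).
Proof.
move=> cle x10 x20 [M1 aM1] [M2 aM2]; exists (M1 * M2) => N.
pose A a := (a1 a)%:R * expR (- x1 * ln (a%:R : R)).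
pose B b := (a2 b)%:R * expR (- x2 * ln (b%:R : R)).
have A0 a : 0 <= A a by rewrite mulr_ge0 ?expR_ge0.
have B0 b : 0 <= B b by rewrite mulr_ge0 ?expR_ge0.
apply: (@le_trans _ _ (\sum_(1 <= a < N.+1) \sum_(1 <= b < N.+1) A a * B b)); last first.
  by rewrite -big_distrlr /= ler_pM ?sumr_ge0.
apply: (@le_trans _ _ (\sum_(1 <= n < N.+1) \sum_(1 <= a < N.+1)
    \sum_(1 <= b < N.+1 | lcmn a b == n) A a * B b)).
  rewrite !big_nat; apply: ler_sum => n /andP[n0 nN].
  rewrite ltnS in nN; have := cle n N nN; rewrite -(ler_nat R) => cn.
  apply: le_trans (ler_wpM2r (expR_ge0 _) cn) _.
  rewrite natr_sum mulr_suml !big_nat; apply: ler_sum => a /andP[a0 _].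
  rewrite natr_sum mulr_suml [leLHS]big_nat_cond [leRHS]big_nat_cond.
  apply: ler_sum => b /andP[/andP[b0 _] /eqP ab].
  have ln_le d : (0 < d)%N -> (d %| n)%N -> ln d%:R <= ln n%:R :> R.
    by move=> d0 dn; rewrite ler_ln ?posrE ?ltr0n// ler_nat dvdn_leq.
  rewrite natrM -mulrA mulrCA /A /B mulrACA -natrM ler_wpM2l//.
  (* Writing [n] as [expR (ln n)] lets it cancel the summand 1 of the exponent. *)
  rewrite -expRD -[X in X * _]lnK ?posrE ?ltr0n// -expRD ler_expR.
  have := ler_wpM2l x10 (ln_le a a0 _); rewrite -{1}ab dvdn_lcml => /(_ isT) la.
  have := ler_wpM2l x20 (ln_le b b0 _); rewrite -{1}ab dvdn_lcmr => /(_ isT) lb.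
  rewrite !mulNr -opprD !mulrDl mul1r [X in _ + X <= _]opprD addrCA subrr addr0.
  by rewrite lerN2 lerD.
(* Each pair has a single least common multiple, so its nonnegative term is counted at most once. *)
rewrite exchange_big /= ler_sum// => a _.
under eq_bigr do rewrite big_mkcond /=.
rewrite exchange_big /= ler_sum// => b _.
rewrite -big_mkcond /= big_const_seq iter_addr_0.
rewrite (eq_count (a2 := pred1 (lcmn a b))); last by move=> n; rewrite /= eq_sym.
rewrite count_uniq_mem ?iota_uniq//; case: (_ \in _) => //=.
by rewrite mulr_ge0.
Qed.

(** * The inequality between abscissas *)

Local Open Scope ereal_scope.

(* [deg1] and [deg2] concern only maps with abscissa -oo. Without them the
   inequality fails, e.g. for the identity of a one-point set and a map T2 with
   infinitely many closed orbits. *)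
Theorem proposition2p8 (R : realType) (X1 X2 : Type)
    (T1 : X1 -> X1) (T2 : X2 -> X2)
    (fin1 : finitely_many_orbits T1) (fin2 : finitely_many_orbits T2)
    (deg1 : orbit_abscissa R T1 = -oo ->
              orbit_abscissa R T2 = -oo \/
              (forall n : nat, (0 < n)%N -> orbit_count T1 n = 0%N))
    (deg2 : orbit_abscissa R T2 = -oo ->
              orbit_abscissa R T1 = -oo \/
              (forall n : nat, (0 < n)%N -> orbit_count T2 n = 0%N)) :
  orbit_abscissa R (prod_map T1 T2) <=
    orbit_abscissa R T1 + orbit_abscissa R T2 + 1%:E.
Proof.
have le_prod n N := @orbit_count_prod _ _ _ _ fin1 fin2 n N.
have supp N : (forall a b, (0 < a)%N -> (0 < b)%N -> (N < lcmn a b)%N ->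
      (orbit_count T1 a * orbit_count T2 b = 0)%N) ->
    orbit_abscissa R (prod_map T1 T2) = -oo.
  move=> h; apply: (@abscissa_finite_support _ _ N) => n nN.
  apply/eqP; rewrite -leqn0; apply: (leq_trans (le_prod n n (leqnn n))).
  rewrite leqn0; apply/eqP; rewrite big_nat big1// => a /andP[a0 _].
  rewrite big_nat_cond big1// => b /andP[/andP[b0 _] /eqP ab].
  by rewrite h ?muln0// ab.
have finite_supp : orbit_abscissa R T1 < 0 -> orbit_abscissa R T2 < 0 ->
    orbit_abscissa R (prod_map T1 T2) = -oo.
  move=> /abscissa_lt0[N1 h1] /abscissa_lt0[N2 h2].
  apply: (supp (N1 * N2)%N) => a b a0 b0 ab.
  have [aN|/h1 ->] := leqP a N1; last by [].
  have [bN|/h2 ->] := leqP b N2; last by rewrite muln0.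
  move: ab; rewrite ltnNge => /negP[]; apply: leq_trans (leq_mul aN bN).
  by rewrite dvdn_leq ?muln_gt0 ?a0// dvdn_lcm dvdn_mulr// dvdn_mull.
(* No abscissa lies strictly between [-oo] and 0. *)
have ltNy (X : Type) (T : X -> X) :
    orbit_abscissa R T < 0 -> orbit_abscissa R T = -oo.
  by move=> /abscissa_lt0[N /abscissa_finite_support].
have [/ltNy n1|p1] := ltP (orbit_abscissa R T1) 0.
  have [n2|z1] := deg1 n1; first by rewrite finite_supp ?n1 ?n2 ?leNye ?ltNyr.
  by rewrite (supp 0%N) ?leNye// => a b a0 _ _; rewrite z1.
have [/ltNy n2|p2] := ltP (orbit_abscissa R T2) 0.
  have [n1|z2] := deg2 n2; first by rewrite finite_supp ?n1 ?n2 ?leNye ?ltNyr.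
  by rewrite (supp 0%N) ?leNye// => a b _ b0 _; rewrite z2 ?muln0.
case E1 : (orbit_abscissa R T1) p1 => [x1| |] // p1; last first.
  by case: (orbit_abscissa R T2) p2 => [x2| |] // _; rewrite addye ?addye ?leey.
case E2 : (orbit_abscissa R T2) p2 => [x2| |] // p2; last first.
  by rewrite addey ?addye ?leey.
rewrite !lee_fin in p1 p2.
(* Boundedness is known only strictly to the right of each abscissa, so each factor is taken at a
   distance [e / 2]. *)
apply/lee_addgt0Pr => e e0; rewrite -!EFinD.
have e20 : (0 < e / 2)%R by rewrite divr_gt0.
rewrite (_ : x1 + x2 + 1 + e = (x1 + e / 2) + (x2 + e / 2) + 1)%R; last first.
  by rewrite [in RHS]addrACA -splitr [LHS]addrAC.
apply: bounded_abscissa_le; apply: (dirichlet_bounded_lcm le_prod).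
- by rewrite addr_ge0 // ltW.
- by rewrite addr_ge0 // ltW.
- by apply: abscissa_lt_bounded; rewrite -/(orbit_abscissa R T1) E1 lte_fin ltrDl.
- by apply: abscissa_lt_bounded; rewrite -/(orbit_abscissa R T2) E2 lte_fin ltrDl.
Qed.
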